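(* Let $N\ge 1$ be an integer and $h=1/N$. There exist constants $0<c<C$ such that $$c\,\|u\|_{\nabla,h}\le\|u\|_h\le C\,\|u\|_{\nabla,h}\qquad\text{for all }u\in D_{0,h}.$$
   Context: Let $N\ge1$ be an integer and $h=1/N$. The grid is $\Omega_h=\{(ih,jh):0\le i,j\le N\}\subset[0,1]^2$. $D_h$ is the real vector space of functions $u:\Omega_h\to\mathbb{R}$, with the notation $u_{i,j}=u(ih,jh)$, and $D_{0,h}\subset D_h$ is the subspace of functions vanishing at all boundary grid points (those with $i\in\{0,N\}$ or $j\in\{0,N\}$). The discrete inner product is $(u,v)_h=h^2\sum_{p\in\Omega_h}u(p)v(p)$, with $\|u\|_h^2=(u,u)_h$. The forward differences are $\nabla_{x+}u_{i,j}=(u_{i+1,j}-u_{i,j})/h$ and $\nabla_{y+}u_{i,j}=(u_{i,j+1}-u_{i,j})/h$. For $u\in D_{0,h}$, $u$ is extended by zero outside the grid, so that these differences are defined on all of $\Omega_h$. For $u\in D_{0,h}$, $\|u\|_{\nabla,h}^2=\|\nabla_{x+}u\|_h^2+\|\nabla_{y+}u\|_h^2$. *)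

(* Defs.v *)
From mathcomp Require Import all_boot all_order all_algebra.
From mathcomp Require Import reals.

Set Implicit Arguments.
Unset Strict Implicit.
Unset Printing Implicit Defensive.

Import Order.TTheory GRing.Theory Num.Theory.
Local Open Scope ring_scope.

(* The grid point (i h, j h), 0 <= i, j <= N, is represented by its pair of
   indices (i, j). *)
Notation grid N := ('I_N.+1 * 'I_N.+1)%type.
Notation gridfun R N := {ffun grid N -> R}.

Definition mesh (R : realType) (N : nat) : R := N%:R^-1.

Arguments mesh : clear implicits.

Definition boundary (N : nat) (p : grid N) : bool :=
  [|| (p.1 == 0 :> nat)%N, (p.1 == N :> nat)%N,
      (p.2 == 0 :> nat)%N | (p.2 == N :> nat)%N].

Definition gridfun0 (R : realType) (N : nat) : {pred gridfun R N} :=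
  [pred u : gridfun R N | [forall p : grid N, boundary p ==> (u p == 0)]].
Arguments gridfun0 : clear implicits.

(* Extension by zero outside the grid.  Forward differences at grid points
   never reach a negative index, so indices in nat suffice. *)
Definition ext0 (R : realType) (N : nat) (u : gridfun R N) (i j : nat) : R :=
  if ((i <= N) && (j <= N))%N then u (inord i, inord j) else 0.

Definition fdiffx (R : realType) (N : nat) (u : gridfun R N) : gridfun R N :=
  [ffun p : grid N => (ext0 u p.1.+1 p.2 - ext0 u p.1 p.2) / mesh R N].

Definition fdiffy (R : realType) (N : nat) (u : gridfun R N) : gridfun R N :=
  [ffun p : grid N => (ext0 u p.1 p.2.+1 - ext0 u p.1 p.2) / mesh R N].

Definition dinner (R : realType) (N : nat) (u v : gridfun R N) : R :=
  mesh R N ^+ 2 * \sum_(p : grid N) u p * v p.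

Definition dnorm (R : realType) (N : nat) (u : gridfun R N) : R :=
  Num.sqrt (dinner u u).

Definition gradnorm (R : realType) (N : nat) (u : gridfun R N) : R :=
  Num.sqrt (dnorm (fdiffx u) ^+ 2 + dnorm (fdiffy u) ^+ 2).

(* Main.v *)
(* On a grid line the increments of [u] bound [u] by Cauchy-Schwarz applied to the
   telescoping sum from the boundary, where [u] vanishes; this gives the
   discrete Poincare inequality, with C = 1 independently of N, already from
   the x-differences. Conversely [(a - b)^2 <= 2 (a^2 + b^2)] gives the inverse
   inequality with c = h / 4. *)
Require Import Defs.
From mathcomp Require Import all_boot all_order all_algebra.
From mathcomp Require Import reals.
From mathcomp Require Import lra.
Import Order.TTheory GRing.Theory Num.Theory.
Local Open Scope ring_scope.

Lemma sqr_sum_le (R : realFieldType) (a : nat -> R) (n : nat) :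
  (\sum_(k < n) a k) ^+ 2 <= n%:R * \sum_(k < n) a k ^+ 2.
Proof.
elim: n => [|n IHn]; first by rewrite !big_ord0 expr0n mul0r.
rewrite !big_ord_recr /= -natr1.
move: IHn; set S := \sum_(i < n) a i; set Q := \sum_(i < n) a i ^+ 2 => IHn.
have [n0|n_gt0] := posnP n.
  by rewrite /S /Q; subst n; rewrite !big_ord0; lra.
have n0 : 0 < n%:R :> R by rewrite ltr0n.
suff : 2 * S * a n <= Q + n%:R * a n ^+ 2 by move: IHn; lra.
(* After multiplication by [n], expanding [(S - n a_n)^2 >= 0] and bounding [S^2] by [n Q] gives the
   claim. *)
rewrite -(ler_pM2l n0).
have := sqr_ge0 (S - n%:R * a n); move: IHn; lra.
Qed.

(** Each [f i] with [i < N] is a sum of [i] increments starting at [f 0 = 0], so its square is at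
    most [N] times the full sum of squared increments. Since [f N = 0], only [N] such terms are
    added, and the factor is [N^2] rather than [N (N + 1)]. *)
Lemma sum_sqr_le_increments (R : realFieldType) (f : nat -> R) (N : nat) :
  f 0%N = 0 -> f N = 0 ->
  \sum_(i < N.+1) f i ^+ 2
    <= N%:R ^+ 2 * \sum_(i < N.+1) (f i.+1 - f i) ^+ 2.
Proof.
move=> f0 fN; rewrite big_ord_recr /= fN expr0n addr0.
set X := \sum_(i < N.+1) _.
have fiX (i : 'I_N) : f i ^+ 2 <= N%:R * X.
  have <- : \sum_(k < i) (f k.+1 - f k) = f i.
    rewrite -(big_mkord xpredT (fun k => f k.+1 - f k)).
    by rewrite telescope_sumr// f0 subr0.
  apply: (le_trans (sqr_sum_le _ (fun k => f k.+1 - f k) i)).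
  apply: ler_pM; rewrite ?ler0n ?ler_nat ?(ltnW (ltn_ord i))//.
    by apply: sumr_ge0 => k _; exact: sqr_ge0.
  rewrite (big_ord_widen N.+1 (fun k => (f k.+1 - f k) ^+ 2)); last exact/leqW/ltnW.
  by rewrite /X big_mkcond; apply: ler_sum => k _; case: ifP; rewrite ?sqr_ge0.
apply: (@le_trans _ _ (\sum_(i < N) N%:R * X)); first exact: ler_sum.
by rewrite sumr_const card_ord -(mulr_natl (_ * X)) mulrA expr2.
Qed.

Lemma sum_sqr_increments_le (R : realFieldType) (f : nat -> R) (n : nat) :
  f n = 0 ->
  \sum_(i < n) (f i.+1 - f i) ^+ 2 <= 4 * \sum_(i < n) f i ^+ 2.
Proof.
move=> fn.
have shift : \sum_(i < n) f i.+1 ^+ 2 <= \sum_(i < n) f i ^+ 2.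
  (* Peels the same sum off at its first and at its last term. *)
  have : \sum_(i < n.+1) f i ^+ 2 = \sum_(i < n.+1) f i ^+ 2 by [].
  rewrite {1}big_ord_recl big_ord_recr /= fn.
  by have := sqr_ge0 (f 0%N); lra.
have : \sum_(i < n) (f i.+1 - f i) ^+ 2
    <= \sum_(i < n) (2 * f i.+1 ^+ 2 + 2 * f i ^+ 2).
  (* Parallelogram identity: [(a - b)^2 + (a + b)^2 = 2 a^2 + 2 b^2]. *)
  by apply: ler_sum => i _; have := sqr_ge0 (f i.+1 + f i); lra.
by rewrite big_split -!mulr_sumr /=; move: shift; lra.
Qed.

Section GridNorms.
Variables (R : realType) (N : nat) (u : gridfun R N).

Lemma dnorm_sqr (v : gridfun R N) :
  dnorm v ^+ 2 = mesh R N ^+ 2 * \sum_(i < N.+1) \sum_(j < N.+1) v (i, j) ^+ 2.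
Proof.
rewrite /dnorm sqr_sqrtr /dinner.
  by rewrite pair_bigA; congr (_ * _); apply: eq_bigr => -[i j] _; rewrite expr2.
by rewrite mulr_ge0 ?sqr_ge0 ?sumr_ge0// => p _; rewrite -expr2 sqr_ge0.
Qed.

Lemma ext0E (i j : 'I_N.+1) : ext0 u i j = u (i, j).
Proof. by rewrite /ext0 !leq_ord /= !inord_val. Qed.

Lemma ext0_outx (j : nat) : ext0 u N.+1 j = 0.
Proof. by rewrite /ext0 ltnn. Qed.

Lemma ext0_outy (i : nat) : ext0 u i N.+1 = 0.
Proof. by rewrite /ext0 ltnn andbF. Qed.

Lemma gridfun0_ext0 (i j : 'I_N.+1) :
  u \in gridfun0 R N -> boundary (i, j) -> ext0 u i j = 0.
Proof.
by move=> /forallP/(_ (i, j))/implyP u0 /u0/eqP; rewrite ext0E.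
Qed.

Hypothesis hN : (0 < N)%N.

Let meshN (x : R) : mesh R N * (x / mesh R N) = x.
Proof. by rewrite mulrC divfK// /mesh invr_eq0 pnatr_eq0 -lt0n. Qed.

(** The weight [h^2] of the norm cancels the [1/h^2] of the squared quotients. The sum over [i] is
    innermost, so that one-dimensional bounds apply on each line of constant [j]. *)
Lemma dnorm_fdiffx_sqr : dnorm (fdiffx u) ^+ 2 =
  \sum_(j < N.+1) \sum_(i < N.+1) (ext0 u i.+1 j - ext0 u i j) ^+ 2.
Proof.
rewrite dnorm_sqr exchange_big mulr_sumr; apply: eq_bigr => j _.
rewrite mulr_sumr; apply: eq_bigr => i _.
by rewrite ffunE -exprMn meshN.
Qed.

Lemma dnorm_fdiffy_sqr : dnorm (fdiffy u) ^+ 2 =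
  \sum_(i < N.+1) \sum_(j < N.+1) (ext0 u i j.+1 - ext0 u i j) ^+ 2.
Proof.
rewrite dnorm_sqr mulr_sumr; apply: eq_bigr => i _.
rewrite mulr_sumr; apply: eq_bigr => j _.
by rewrite ffunE -exprMn meshN.
Qed.

Lemma dnorm_fdiffx_le :
  mesh R N ^+ 2 * dnorm (fdiffx u) ^+ 2 <= 4 * dnorm u ^+ 2.
Proof.
rewrite dnorm_fdiffx_sqr dnorm_sqr [X in _ <= 4 * (_ * X)]exchange_big.
rewrite mulrCA ler_wpM2l ?sqr_ge0//.
rewrite mulr_sumr; apply: ler_sum => j _.
under [X in _ <= _ * X]eq_bigr => i _ do rewrite -ext0E.
(* The endpoint is index [N + 1], just outside the grid, where the extension is zero. *)
apply: (sum_sqr_increments_le _ (fun i => ext0 u i j)).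
exact: ext0_outx.
Qed.

Lemma dnorm_fdiffy_le :
  mesh R N ^+ 2 * dnorm (fdiffy u) ^+ 2 <= 4 * dnorm u ^+ 2.
Proof.
rewrite dnorm_fdiffy_sqr dnorm_sqr mulrCA ler_wpM2l ?sqr_ge0//.
rewrite mulr_sumr; apply: ler_sum => i _.
under [X in _ <= _ * X]eq_bigr => j _ do rewrite -ext0E.
apply: (sum_sqr_increments_le _ (ext0 u i)).
exact: ext0_outy.
Qed.

Lemma discrete_poincare :
  u \in gridfun0 R N -> dnorm u ^+ 2 <= dnorm (fdiffx u) ^+ 2.
Proof.
move=> u0; rewrite dnorm_fdiffx_sqr dnorm_sqr exchange_big mulr_sumr.
(* The weight [h^2 = 1/N^2] absorbs the factor [N^2] of the one-dimensional bound. *)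
apply: ler_sum => j _; rewrite /mesh exprVn ler_pdivrMl ?exprn_gt0 ?ltr0n//.
under eq_bigr => i _ do rewrite -ext0E.
apply: (sum_sqr_le_increments _ (fun i => ext0 u i j)).
  exact: (gridfun0_ext0 ord0).
by apply: (gridfun0_ext0 ord_max) => //; rewrite /boundary eqxx orbT.
Qed.

End GridNorms.

Theorem lemma3 (R : realType) (N : nat) (hN : (1 <= N)%N) :
  exists c C : R, [/\ 0 < c, c < C &
    forall u : gridfun R N, u \in gridfun0 R N ->
      c * gradnorm u <= dnorm u <= C * gradnorm u].
Proof.
have h_gt0 : 0 < mesh R N by rewrite invr_gt0 ltr0n.
have h_le1 : mesh R N <= 1 by rewrite invf_le1 ?ltr0n// ler1n.
exists (mesh R N / 4), 1; split=> [| |u u0]; [lra|lra|].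
have grad_sqr : gradnorm u ^+ 2 = dnorm (fdiffx u) ^+ 2 + dnorm (fdiffy u) ^+ 2.
  by rewrite sqr_sqrtr// addr_ge0 ?sqr_ge0.
have d_ge0 : 0 <= dnorm u by exact: sqrtr_ge0.
have g_ge0 : 0 <= gradnorm u by exact: sqrtr_ge0.
have c_ge0 : 0 <= mesh R N / 4 by lra.
rewrite mul1r; apply/andP; split.
  rewrite -ler_sqr ?nnegrE ?(mulr_ge0 c_ge0)// exprMn grad_sqr.
  (* The two bounds add up to [h^2 |grad u|^2 <= 8 |u|^2], and [c^2 = h^2 / 16]. *)
  have := dnorm_fdiffx_le _ _ u hN; have := dnorm_fdiffy_le _ _ u hN.
  by have := sqr_ge0 (dnorm u); lra.
rewrite -ler_sqr ?nnegrE// grad_sqr.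
have := discrete_poincare _ _ u hN u0.
by have := sqr_ge0 (dnorm (fdiffy u)); lra.
Qed.
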